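(* Let $X$ be a locally compact Polish space and let $\sigma$ be a non-atomic Radon measure on $X$ with $\sigma(X)=\infty$. Let $\Lambda^{(n)}\in\mathscr B_0(X)$, $n\in\mathbb N$, be such that $\Lambda^{(1)}\subset\Lambda^{(2)}\subset\cdots$, $\bigcup_n\Lambda^{(n)}=X$, and $\sigma(\Lambda^{(n)})>0$ (so $\sigma(\Lambda^{(n)})\to\infty$). For each $n$, let $A(\Lambda^{(n)};f)$, $f\in B_0(X)$, and $\tau_{\Lambda^{(n)}}$ be the operators and the trace describing a random number of freely independent particles in $\Lambda^{(n)}$, each with distribution $\sigma^{(n)}=\frac1{\sigma(\Lambda^{(n)})}\sigma$ on $\Lambda^{(n)}$, where the number of particles has Poisson distribution with parameter $\alpha=\sigma(\Lambda^{(n)})$. Let $A(f)$, $f\in B_0(X)$, and $\tau$ be the operators and the vacuum trace of the free Poisson process on $X$ with intensity measure $\sigma$. Then, for any $k\in\mathbb N$ and any $f_1,\dots,f_k\in B_0(X)$, $$\lim_{n\to\infty}\tau_{\Lambda^{(n)}}\big(A(\Lambda^{(n)};f_1)\cdots A(\Lambda^{(n)};f_k)\big)=\tau\big(A(f_1)\cdots A(f_k)\big).$$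
   Context: $\mathscr B_0(X)$ is the collection of Borel subsets of $X$ with compact closure. A measure on the Borel $\sigma$-algebra of $X$ is Radon if it is finite on every set of $\mathscr B_0(X)$. $B_0(X)$ is the set of all bounded measurable functions $f:X\to\mathbb R$ with compact support. All Hilbert spaces are real. **Free Poisson process.** For a real separable Hilbert space $H$, the full Fock space is $\mathscr F(H)=\bigoplus_{n=0}^\infty H^{\otimes n}$, $H^{\otimes 0}=\mathbb R$, with vacuum $\Omega=(1,0,0,\dots)$. For $h\in H$, $a^+(h)$ is the bounded operator with $a^+(h)f^{(n)}=h\otimes f^{(n)}$ for $f^{(n)}\in H^{\otimes n}$, and $a^-(h)$ is its adjoint, so that $a^-(h)\Omega=0$ and $a^-(h)f_1\otimes\dots\otimes f_n=(h,f_1)_H f_2\otimes\dots\otimes f_n$. For a bounded operator $L$ in $H$, $a^0(L)\Omega=0$ and $a^0(L)f_1\otimes\dots\otimes f_n=(Lf_1)\otimes f_2\otimes\dots\otimes f_n$. The free Poisson process on $X$ with intensity $\sigma$ is the family of bounded selfadjoint operators in $\mathscr F(L^2(X,\sigma))$ $$A(f)=a^+(f)+a^0(f)+a^-(f)+\int_X f\,d\sigma,\qquad f\in B_0(X),$$ where in $a^0(f)$ the function $f$ is identified with the operator of multiplication by $f$. On the algebra generated by these operators, $\tau(a)=(a\Omega,\Omega)_{\mathscr F(L^2(X,\sigma))}$. **$N$ freely independent particles.** Let $\Lambda\in\mathscr B_0(X)$, let $P_\Lambda$ be a probability measure on $\Lambda$, and $N\in\mathbb N$. Functions $f\in B_0(X)$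 are restricted to $\Lambda$. Put $\langle f\rangle=\int_\Lambda f\,dP_\Lambda$ and $H=\{f\in L^2(\Lambda,P_\Lambda):\langle f\rangle=0\}$, and let $H_1,\dots,H_N$ be $N$ copies of $H$. Define $$\mathscr H(\Lambda,N)=\mathbb R\oplus\bigoplus_{\substack{k\in\mathbb N,\ l_1,\dots,l_k\in\{1,\dots,N\}\\ l_j\ne l_{j+1}}}H_{l_1}\otimes\dots\otimes H_{l_k},\qquad \Psi_N=(1,0,0,\dots).$$ For $g\in L^2(\Lambda,P_\Lambda)$ let $[g]_i:=g-\langle g\rangle\in H_i$. For $i\in\{1,\dots,N\}$ and $f\in B_0(X)$, $M_i(\Lambda;f)$ is the bounded linear operator in $\mathscr H(\Lambda,N)$ given by $M_i(\Lambda;f)\Psi_N=\langle f\rangle\Psi_N+[f]_i$ and, for $g_j\in H_{l_j}$ with $l_j\neq l_{j+1}$: if $i\ne l_1$, $M_i(\Lambda;f)g_1\otimes\dots\otimes g_k=\langle f\rangle g_1\otimes\dots\otimes g_k+[f]_i\otimes g_1\otimes\dots\otimes g_k$; if $i=l_1$, $M_i(\Lambda;f)g_1\otimes\dots\otimes g_k=\langle fg_1\rangle g_2\otimes\dots\otimes g_k+[fg_1]_i\otimes g_2\otimes\dots\otimes g_k$ (for $k=1$, $g_2\otimes\dots\otimes g_k$ means $\Psi_N$ in the first term and is absent in the second). Put $A(\Lambda,N;f)=\sum_{i=1}^N M_i(\Lambda;f)$. For $N=0$ put $\mathscr H(\Lambda,0)=\mathbb R$, $\Psi_0=1$, $A(\Lambda,0;f)=0$.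 **Poisson number of freely independent particles.** For $\alpha>0$ let $\mathscr H(\Lambda)=\bigoplus_{N=0}^\infty\mathscr H(\Lambda,N)\frac{\alpha^N}{N!}e^{-\alpha}$, where $\mathscr Hc$ denotes $\mathscr H$ with scalar product multiplied by $c>0$. On the dense subspace of finite sequences $(F_0,F_1,\dots,F_k,0,0,\dots)$, $F_i\in\mathscr H(\Lambda,i)$, define $A(\Lambda;f)=\sum_{N=0}^\infty A(\Lambda,N;f)$, where $A(\Lambda,N;f)$ acts in the component $\mathscr H(\Lambda,N)$. On the algebra generated by the operators $A(\Lambda;f)$, $f\in B_0(X)$, define $$\tau_\Lambda(a)=\sum_{N=0}^\infty(a\Psi_N,\Psi_N)_{\mathscr H(\Lambda,N)}\frac{\alpha^N}{N!}e^{-\alpha}$$ (the series converges). In the claim this is used with $\Lambda=\Lambda^{(n)}$, $P_\Lambda=\sigma^{(n)}$, $\alpha=\sigma(\Lambda^{(n)})$. *)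

(* Defs.v *)
From HB Require Import structures.
From mathcomp Require Import all_boot all_order all_algebra.
From mathcomp Require Import all_classical all_reals all_analysis.

Set Implicit Arguments.
Unset Strict Implicit.
Unset Printing Implicit Defensive.

Import Order.TTheory GRing.Theory Num.Theory.
Import numFieldNormedType.Exports.

Local Open Scope classical_set_scope.
Local Open Scope ring_scope.

HB.mixin Record isHilbert (R : realType) V & CompleteNormedModule R V := {
  dotp : V -> V -> R;
  dotpC : forall u v, dotp u v = dotp v u;
  dotpPl : forall (a : R) u v w, dotp (a *: u + v) w = a * dotp u w + dotp v w;
  dotp_norm : forall u, dotp u u = `|u| ^+ 2
}.

#[short(type="hilbertType")]
HB.structure Definition Hilbert (R : realType) :=
  {V of isHilbert R V & CompleteNormedModule R V}.

Definition lin_span (R : realType) (V : lmodType R) (S : set V) : set V :=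
  [set v | exists n (c : 'I_n -> R) (w : 'I_n -> V),
     (forall i, S (w i)) /\ v = \sum_(i < n) c i *: w i].

Definition bounded_op (R : realType) (V : normedModType R) (A : V -> V) :=
  exists C : R, forall u, `|A u| <= C * `|u|.

Definition polish_space (R : realType) (X : topologicalType) :=
  (exists2 D : set X, countable D & dense D) /\
  exists (Y : completePseudoMetricType R) (h : X -> Y) (g : Y -> X),
    [/\ hausdorff_space Y, cancel h g, cancel g h, continuous h & continuous g].

Notation borelType X := (g_sigma_algebraType (@open X)).

Section BorelSpace.
Context (R : realType) (X : ptopologicalType).
Implicit Types (A B : set (borelType X)) (f : borelType X -> R).

Definition B0set A := measurable A /\ compact (closure (A : set X)).

Definition B0fun f :=
  [/\ measurable_fun setT f, (exists C : R, forall x, `|f x| <= C)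
    & compact (closure ([set x | f x != 0] : set X))].

Context (mu : {measure set (borelType X) -> \bar R}).

Definition radon := forall A, B0set A -> (mu A < +oo)%E.

Definition nonatomic := ~ exists A,
  [/\ measurable A, (0 < mu A)%E &
      forall B, measurable B -> B `<=` A -> (mu B < mu A)%E -> mu B = 0%E].

Definition dotL2 f g : R := \int[mu]_x (f x * g x).

End BorelSpace.

Section FreePoisson.
Context (R : realType) (X : ptopologicalType).
Context (sigma : {measure set (borelType X) -> \bar R}).
Local Notation T := (borelType X).

(* [fock] is the Hilbert sum over n of the Hilbert tensor powers of
   L^2(sigma), given by its elementary tensors: [tensor [:: f1; ..; fn]] is
   f1 (x) .. (x) fn, and the two axioms determine [fock] up to a unique unitary
   map preserving elementary tensors. Elements of L^2(sigma) are given by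
   square integrable representatives; by the first axiom [tensor] does not
   depend on them and is multilinear. *)
Record fullFock := FullFock {
  fock :> hilbertType R;
  tensor : seq (T -> R) -> fock;
  dotp_tensor : forall s t,
    all [in Lfun sigma 2%:E] s -> all [in Lfun sigma 2%:E] t ->
    dotp (tensor s) (tensor t) =
    if size s == size t then \prod_(p <- zip s t) dotL2 sigma p.1 p.2 else 0;
  tensor_total : dense
    (lin_span [set tensor s | s in [set s | all [in Lfun sigma 2%:E] s]])
}.

Definition vacuum (F : fullFock) : F := tensor F [::].

(* [a0 f] is a^0 of the operator of multiplication by f. Arguments outside
   L^2(sigma), resp. B_0(X), are irrelevant. *)
Record fockOperators (F : fullFock) := FockOperators {
  aplus : (T -> R) -> {linear F -> F};
  aplus_bounded : forall h, h \in Lfun sigma 2%:E -> bounded_op (aplus h);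
  aplusE : forall h s, h \in Lfun sigma 2%:E -> all [in Lfun sigma 2%:E] s ->
    aplus h (tensor F s) = tensor F (h :: s);
  aminus : (T -> R) -> {linear F -> F};
  aminus_bounded : forall h, h \in Lfun sigma 2%:E -> bounded_op (aminus h);
  aminus_adjoint : forall h, h \in Lfun sigma 2%:E ->
    forall u v, dotp (aminus h u) v = dotp u (aplus h v);
  a0 : (T -> R) -> {linear F -> F};
  a0_bounded : forall f, B0fun f -> bounded_op (a0 f);
  a0_vacuum : forall f, B0fun f -> a0 f (vacuum F) = 0;
  a0E : forall f g s, B0fun f -> g \in Lfun sigma 2%:E ->
    all [in Lfun sigma 2%:E] s ->
    a0 f (tensor F (g :: s)) = tensor F ((f \* g) :: s)
}.

Definition free_poisson (F : fullFock) (a : fockOperators F) (f : T -> R)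
    (u : F) : F :=
  aplus a f u + a0 a f u + aminus a f u + (\int[sigma]_x f x) *: u.

Definition vacuum_trace (F : fullFock) (a : F -> F) : R :=
  dotp (a (vacuum F)) (vacuum F).

End FreePoisson.

Section FreeParticles.
Context (R : realType) (X : ptopologicalType).
(* The law P_Lambda of a particle, seen as a probability measure on X
   concentrated on Lambda; L^2(Lambda, P_Lambda) is then L^2(X, P). *)
Context (P : probability (borelType X) R).
Local Notation T := (borelType X).

Definition mean (f : T -> R) : R := \int[P]_x f x.

Definition centering (f : T -> R) : T -> R := fun x => f x - mean f.

Definition centered : pred (T -> R) :=
  [pred g | (g \in Lfun P 2%:E) && (mean g == 0)].

(* The word [:: (l1, g1); ..; (lk, gk)] stands for g1 (x) .. (x) gk in
   H_l1 (x) .. (x) H_lk, where neighbouring letters differ. *)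
Definition alternating N (s : seq ('I_N * (T -> R))) : bool :=
  sorted [rel i j | i != j] (unzip1 s) && all centered (unzip2 s).

(* For N = 0 the only word is the empty one and [ptensor] identifies the space
   with R. *)
Record particleSpace (N : nat) := ParticleSpace {
  pspace :> hilbertType R;
  ptensor : seq ('I_N * (T -> R)) -> pspace;
  dotp_ptensor : forall s t, alternating s -> alternating t ->
    dotp (ptensor s) (ptensor t) =
    if unzip1 s == unzip1 t
    then \prod_(p <- zip (unzip2 s) (unzip2 t)) dotL2 P p.1 p.2 else 0;
  ptensor_total : dense (lin_span [set ptensor s | s in [set s | alternating s]])
}.

Definition pvacuum N (K : particleSpace N) : K := ptensor K [::].

Record particleOperators N (K : particleSpace N) := ParticleOperators {
  pmul : 'I_N -> (T -> R) -> {linear K -> K};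
  pmul_bounded : forall i f, B0fun f -> bounded_op (pmul i f);
  pmul_vacuum : forall i f, B0fun f ->
    pmul i f (pvacuum K) = mean f *: pvacuum K + ptensor K [:: (i, centering f)];
  pmul_neq : forall i f l g s, B0fun f -> alternating ((l, g) :: s) -> i != l ->
    pmul i f (ptensor K ((l, g) :: s)) =
    mean f *: ptensor K ((l, g) :: s)
      + ptensor K [:: (i, centering f), (l, g) & s];
  pmul_eq : forall i f g s, B0fun f -> alternating ((i, g) :: s) ->
    pmul i f (ptensor K ((i, g) :: s)) =
    mean (f \* g) *: ptensor K s + ptensor K ((i, centering (f \* g)) :: s)
}.

Definition particles N (K : particleSpace N) (M : particleOperators K)
    (f : T -> R) (u : K) : K :=
  \sum_(i < N) pmul M i f u.

Lemma particles0 N (K : particleSpace N) (M : particleOperators K) f :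
  particles M f 0 = 0.
Proof. by rewrite /particles big1// => i _; rewrite linear0. Qed.

Context (K : forall N, particleSpace N) (M : forall N, particleOperators (K N)).

(* The dense subspace of finite sequences in the Hilbert sum of the [K N]
   weighted by the Poisson probabilities. *)
Record finSeq := FinSeq {
  comp_of :> forall N, K N;
  comp_of_fin : exists m, forall N, (m <= N)%N -> comp_of N = 0
}.

Lemma poisson_particles_fin f (F : finSeq) :
  exists m, forall N, (m <= N)%N -> particles (M N) f (F N) = 0.
Proof.
by have [m Fm] := comp_of_fin F; exists m => N /Fm ->; rewrite particles0.
Qed.

Definition poisson_particles (f : T -> R) (F : finSeq) : finSeq :=
  FinSeq (poisson_particles_fin f F).

Lemma inj_vacuum_fin N : exists m, forall N', (m <= N')%N ->
  dfwith (fun N' => 0 : K N') N (pvacuum (K N)) N' = 0.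
Proof.
by exists N.+1 => N' NN'; rewrite dfwithout// neq_ltn NN'.
Qed.

Definition inj_vacuum (N : nat) : finSeq := FinSeq (inj_vacuum_fin N).

Definition poisson_trace (alpha : R) (a : finSeq -> finSeq) : R :=
  limn (series (fun N => dotp (a (inj_vacuum N) N) (pvacuum (K N)) *
                         (alpha ^+ N / N`!%:R * expR (- alpha)))).

End FreeParticles.

(* sigma / sigma(L) on L; the Dirac mass is the default value of [mnormalize],
   which is used only if sigma(L) is 0 or +oo. *)
Definition normalized_restr (R : realType) (X : ptopologicalType)
    (sigma : {measure set (borelType X) -> \bar R}) (L : set (borelType X))
    (mL : measurable L) : probability (borelType X) R :=
  mnormalize (mrestr sigma mL) \d_(point : borelType X).

(* Main.v *)
Require Import Defs.
From mathcomp Require Import all_boot all_order all_algebra.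
From mathcomp Require Import all_classical all_reals all_analysis.
From mathcomp Require Import measurable_realfun ring.

Set Implicit Arguments.
Unset Strict Implicit.
Unset Printing Implicit Defensive.

Import Order.TTheory GRing.Theory Num.Theory.
Import numFieldNormedType.Exports.

Local Open Scope classical_set_scope.
Local Open Scope ring_scope.

(** Both families of operators act on words of functions by nearly the same
    rule, and the two rules agree in the limit.

    On the Fock side, A(f) sends a tensor g :: s to the sum of four terms:
    f is put in front, f multiplies g, f and g are contracted to the number
    given by the integral of f g, and the tensor is multiplied by the integral
    of f ([free_poisson_cons]).

    For N particles in Lambda, the vectors [sym_tensor s] play the role of
    tensors: the letters of s are centred, and the elementary tensors are summed
    over all ways to attribute the letters to particles so that neighbours
    belong to different particles. Such sums are stable under the operator
    summed over the particles ([particles_sym_tensor_cons]): multiplying the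
    first letter by f within its own particle gives the product and the
    contraction, while the other N - 1 particles put f in front and produce the
    scalar (N - 1) <f>. The new coefficients are N, N - 1 and means with respect
    to the normalised measure. With alpha the measure of Lambda, a mean is an
    integral over Lambda divided by alpha; hence every coefficient is
    c * (N / alpha) + d, where c converges to the coefficient of the Fock side
    and d tends to 0, or it carries a bare mean and tends to 0.

    It remains to see that N / alpha acts as 1 on Poisson averages when alpha
    tends to infinity. The notion [poisson_limit] builds this into the mode of
    convergence: it asks for convergence of the averages of a quantity weighted
    by each normalised falling factorial of N. The Poisson average of the
    normalised falling factorials is 1, and multiplication by N / alpha only
    shifts their order up to an error j / alpha, so that the notion is preserved
    by the factor N / alpha ([poisson_limitX]). Induction on the number of
    operators, with the word s arbitrary, then gives the convergence of all
    vacuum expectations ([poisson_limit_words]). *)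

(** * Inner products *)

Section HilbertTheory.
Context (R : realType) (V : hilbertType R).
Implicit Types (u v w : V) (c : R).

Lemma dotpDl u v w : dotp (u + v) w = dotp u w + dotp v w.
Proof. by have := dotpPl 1 u v w; rewrite scale1r mul1r. Qed.

Lemma dotp0l w : dotp (0 : V) w = 0.
Proof. by apply: (addIr (dotp 0 w)); rewrite -dotpDl !add0r. Qed.

Lemma dotpZl c u w : dotp (c *: u) w = c * dotp u w.
Proof. by rewrite -[c *: u]addr0 dotpPl dotp0l addr0. Qed.

Lemma dotpNl u w : dotp (- u) w = - dotp u w.
Proof. by rewrite -scaleN1r dotpZl mulN1r. Qed.

Lemma dotpDr u v w : dotp u (v + w) = dotp u v + dotp u w.
Proof. by rewrite !(dotpC u) dotpDl. Qed.

Lemma dotpZr c u w : dotp u (c *: w) = c * dotp u w.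
Proof. by rewrite !(dotpC u) dotpZl. Qed.

Lemma dotp_eq0 u : dotp u u = 0 -> u = 0.
Proof. by rewrite dotp_norm => /eqP; rewrite sqrf_eq0 normr_eq0 => /eqP. Qed.

Lemma dotp_suml (I : Type) (r : seq I) (F : I -> V) w :
  dotp (\sum_(i <- r) F i) w = \sum_(i <- r) dotp (F i) w.
Proof.
by apply: (big_morph (fun u => dotp u w)) => [x y|]; rewrite ?dotpDl ?dotp0l.
Qed.

(** Pythagoras suffices: if u is orthogonal to w, then the distance from u to w
    is at least the norm of u, while some w in the span comes closer. *)
Lemma orthogonal_dense_eq0 (S : set V) u :
  dense (lin_span S) -> (forall v, S v -> dotp u v = 0) -> u = 0.
Proof.
move=> dS uS; apply/eqP/negPn/negP => u0.
have u_gt0 : 0 < `|u| by rewrite normr_gt0.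
have [|w [uw [n [c [g [Sg wE]]]]]] := dS (ball u `|u|) _ (ball_open _ _).
  by exists u; exact: ballxx.
have uw0 : dotp u w = 0.
  rewrite dotpC wE dotp_suml big1// => i _.
  by rewrite dotpZl dotpC uS ?mulr0.
move: uw; rewrite -ball_normE /= => uw.
have : `|u| ^+ 2 <= `|u - w| ^+ 2.
  rewrite -!dotp_norm -scaleN1r !(dotpDl, dotpDr, dotpZl, dotpZr).
  rewrite (dotpC w u) uw0 !mulr0 add0r addr0 mulrA mulrNN !mul1r.
  by rewrite lerDl dotp_norm sqr_ge0.
by rewrite ler_sqr ?nnegrE// leNgt uw.
Qed.

End HilbertTheory.

(** * Integrals of bounded functions *)

Lemma RintegralBZ d (T : measurableType d) (R : realType)
    (mu : {measure set T -> \bar R}) (f g : T -> R) (c : R) :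
  mu.-integrable setT (EFin \o f) -> mu.-integrable setT (EFin \o g) ->
  \int[mu]_x (f x - c * g x) = \int[mu]_x f x - c * \int[mu]_x g x.
Proof.
move=> intf intg; rewrite -RintegralZl// -RintegralB//.
rewrite (_ : EFin \o _ = (fun x => c%:E * (EFin \o g) x)%E).
  exact: integrableZl.
by apply/funext => x; rewrite /= EFinM.
Qed.

Lemma integrable_sqr_Lfun2 d (U : measurableType d) (R : realType)
    (mu : {measure set U -> \bar R}) (f : U -> R) :
  measurable_fun setT f -> mu.-integrable setT (EFin \o (f \* f)) ->
  f \in Lfun mu 2%:E.
Proof.
move=> mf /integrableP[_ intf]; rewrite inE; apply/andP; split; rewrite inE//=.
rewrite /finite_norm unlock /Lnorm poweR_lty//.
apply: le_lt_trans intf; apply: ge0_le_integral => //=.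
- apply/measurable_EFinP.
  apply: (@measurableT_comp _ _ _ _ _ _ (@powR R ^~ 2)) => //.
  exact: measurableT_comp.
- apply/measurable_EFinP; apply: measurableT_comp => //.
  exact: measurable_funM.
by move=> x _; rewrite lee_fin powR_mulrn// -normrX expr2.
Qed.

Section BoundedMeasurable.
Context (R : realType) d (T : measurableType d) (P : probability T R).

Definition bounded_mfun (f : T -> R) :=
  measurable_fun setT f /\ exists C : R, forall x, `|f x| <= C.

Lemma bounded_mfunM f g :
  bounded_mfun f -> bounded_mfun g -> bounded_mfun (f \* g).
Proof.
move=> [mf [C fC]] [mg [D gD]]; split; first exact: measurable_funM.
by exists (C * D) => x; rewrite normrM ler_pM.
Qed.

Lemma bounded_mfunBZ f g (c : R) : bounded_mfun f -> bounded_mfun g ->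
  bounded_mfun (fun x => f x - c * g x).
Proof.
move=> [mf [C fC]] [mg [D gD]]; split.
  by apply: measurable_funB => //; exact: measurable_funM.
exists (C + `|c| * D) => x; apply: (le_trans (ler_normB _ _)).
by rewrite lerD// normrM ler_wpM2l.
Qed.

Lemma bounded_mfun_cst (c : R) : bounded_mfun (fun=> c).
Proof. by split; [exact: measurable_cst|exists `|c|]. Qed.

Lemma bounded_mfun_integrable f : bounded_mfun f ->
  P.-integrable setT (EFin \o f).
Proof.
move=> [mf [C fC]]; apply: measurable_bounded_integrable => //.
  by rewrite (le_lt_trans (probability_le1 _ _))// ltry.
exists C; split; first exact: num_real.
by move=> D CD x _; apply: (le_trans (fC x)); exact: ltW.
Qed.

End BoundedMeasurable.

Lemma integral_mscale d (U : measurableType d) (R : realType)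
    (mu : {measure set U -> \bar R})
    (D : set U) (k : {nonneg R}) (f : U -> \bar R) :
  measurable D -> mu.-integrable D f ->
  (\int[mscale k mu]_(x in D) f x = k%:num%:E * \int[mu]_(x in D) f x)%E.
Proof.
move=> mD intf; have mf := measurable_int _ intf.
rewrite [LHS]integralE [X in (_ * X)%E]integralE muleBr//; last first.
  exact: integrable_add_def.
by rewrite !ge0_integral_mscale//;
  [exact: measurable_funeneg|exact: measurable_funepos].
Qed.

Section B0functions.
Context (R : realType) (X : ptopologicalType).
Context (sigma : {measure set (borelType X) -> \bar R}).
Context (sigma_radon : radon sigma).
Local Notation T := (borelType X).
Implicit Types f g : T -> R.

Lemma B0funM (f g : T -> R) : B0fun f -> B0fun g -> B0fun (f \* g).
Proof.
move=> [mf [C fC] cf] [mg [D gD] cg]; split.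
- exact: measurable_funM.
- exists (C * D) => x; rewrite normrM ler_pM//.
apply: (@subclosed_compact X _ _ _ cf); first exact: closed_closure.
apply: (@closure_subset X) => x /=; by apply: contra_neq => ->; rewrite mul0r.
Qed.

(** A bounded function is dominated by a constant on the set where it does not
    vanish, and this set has finite measure. *)
Lemma B0fun_integrable f : B0fun f -> sigma.-integrable setT (EFin \o f).
Proof.
move=> [mf [C fC] cf].
pose D := [set x | f x != 0] : set T.
have mD : measurable D.
  rewrite (_ : D = f @^-1` [set~ 0]).
    by rewrite -[X in measurable X]setTI; apply: mf => //; exact: measurableC.
  by apply/seteqP; split => x /=; rewrite /D/= => /eqP.
have Dfin : (sigma D < +oo)%E by apply: sigma_radon.
apply/integrableP; split; first exact/measurable_EFinP.
apply: (@le_lt_trans _ _ (\int[sigma]_(x in D) C%:E)%E); last first.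
  rewrite integral_cst//.
  by rewrite lte_mul_pinfty// lee_fin (le_trans (normr_ge0 (f point))).
rewrite [leRHS]integral_mkcond; apply: ge0_le_integral => //=.
- by do 2 apply: measurableT_comp => //; apply/measurable_EFinP.
- apply/(measurable_restrictT _ mD); exact: measurable_cst.
move=> x _; rewrite patchE; case: ifPn => [|/negP]; first by rewrite lee_fin.
rewrite inE /D /= => /negP; rewrite negbK => /eqP ->; by rewrite normr0.
Qed.

Lemma B0fun_Lfun2 f : B0fun f -> f \in Lfun sigma 2%:E.
Proof.
move=> Bf; apply: integrable_sqr_Lfun2; first by case: Bf.
exact/B0fun_integrable/B0funM.
Qed.

Lemma B0fun_bounded_mfun f : B0fun f -> bounded_mfun f.
Proof. by case. Qed.

End B0functions.

(** * The free Poisson process on tensors *)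

Section FockAction.
Context (R : realType) (X : ptopologicalType).
Context (sigma : {measure set (borelType X) -> \bar R}).
Context (sigma_radon : radon sigma).
Context (F : fullFock sigma) (a : fockOperators F).
Local Notation T := (borelType X).
Local Notation L2 := (Lfun sigma 2%:E).
Implicit Types (f g h : T -> R) (s : seq (T -> R)).

(** Annihilation operators are only known as adjoints of creation operators, so
    their values are recognised by testing against the total set of tensors. *)
Lemma aminus_vacuum h : h \in L2 -> aminus a h (vacuum F) = 0.
Proof.
move=> h2; apply: (orthogonal_dense_eq0 (tensor_total (f := F))).
move=> _ [t /= t2 <-]; rewrite aminus_adjoint// aplusE// dotp_tensor//=.
by rewrite h2.
Qed.

Lemma aminus_tensor h g s : h \in L2 -> g \in L2 -> all [in L2] s ->
  aminus a h (tensor F (g :: s)) = dotL2 sigma h g *: tensor F s.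
Proof.
move=> h2 g2 s2; apply/eqP; rewrite -subr_eq0; apply/eqP.
apply: (orthogonal_dense_eq0 (tensor_total (f := F))).
move=> _ [t /= t2 <-].
rewrite dotpDl dotpNl dotpZl aminus_adjoint// aplusE//.
rewrite !dotp_tensor ?inE /= ?g2 ?h2//.
rewrite eqSS; case: eqP => _; last by rewrite mulr0 subrr.
rewrite big_cons/= (_ : dotL2 sigma g h = dotL2 sigma h g) ?subrr//.
by congr Rintegral; apply/funext => x; rewrite mulrC.
Qed.

Lemma free_poisson_vacuum f : B0fun f ->
  free_poisson a f (tensor F [::]) =
  (\int[sigma]_x f x) *: tensor F [::] + tensor F [:: f].
Proof.
move=> Bf; have f2 := B0fun_Lfun2 sigma_radon Bf.
rewrite /free_poisson aplusE// aminus_vacuum// a0_vacuum//.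
by rewrite !addr0 addrC.
Qed.

Lemma free_poisson_cons f g s : B0fun f -> B0fun g -> all [in L2] s ->
  free_poisson a f (tensor F (g :: s)) =
  (\int[sigma]_x f x) *: tensor F (g :: s) + (tensor F [:: f, g & s] +
  ((\int[sigma]_x (f x * g x)) *: tensor F s + tensor F (f \* g :: s))).
Proof.
move=> Bf Bg s2; have f2 := B0fun_Lfun2 sigma_radon Bf.
have g2 := B0fun_Lfun2 sigma_radon Bg.
rewrite /free_poisson aplusE ?aminus_tensor ?a0E//= ?g2//.
by rewrite addrC -!addrA [tensor F (_ \* _ :: _) + _]addrC.
Qed.

Lemma free_poisson_linear f : linear (free_poisson a f).
Proof.
move=> c u v; rewrite /free_poisson !linearP !scalerDr.
by rewrite [X in X + _ + _ = _]addrACA [X in X + _ = _]addrACA [LHS]addrACA.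
Qed.

End FockAction.

(** * Sums over alternating words of labels *)

Section AltSum.
Context (N : nat).

Definition neq_head (i : 'I_N) (l : seq 'I_N) :=
  if l is j :: _ then i != j else true.

Lemma sorted_neq_head i l :
  sorted [rel i j : 'I_N | i != j] (i :: l) =
  neq_head i l && sorted [rel i j : 'I_N | i != j] l.
Proof. by case: l. Qed.

(** The sum of G over the words of k labels without equal neighbours. The
    recursion makes the label of the front letter the innermost index, so that
    putting a letter in front of a word, or acting on its front letter, is
    computation under [alt_sum]. *)
Fixpoint alt_sum (V : nmodType) k (G : seq 'I_N -> V) : V :=
  if k is k'.+1
  then alt_sum k' (fun l => \sum_(i | neq_head i l) G (i :: l))
  else G [::].

Lemma eq_alt_sum (V : nmodType) k (G G' : seq 'I_N -> V) :
  (forall l, size l = k -> sorted [rel i j | i != j] l -> G l = G' l) ->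
  alt_sum k G = alt_sum k G'.
Proof.
elim: k G G' => [|k IH] G G' GG' /=; first exact: GG'.
apply: IH => l lk sl; apply: eq_bigr => i il; apply: GG' => /=; first by rewrite lk.
by have := sorted_neq_head i l; rewrite il sl.
Qed.

Lemma alt_sum_morph (V W : nmodType) (phi : V -> W) k G :
  {morph phi : x y / x + y} -> phi 0 = 0 ->
  phi (alt_sum k G) = alt_sum k (phi \o G).
Proof.
move=> phiD phi0; elim: k G => [|k IH] G //=; rewrite IH.
by apply: eq_alt_sum => l _ _ /=; rewrite (big_morph phi phiD phi0).
Qed.

Lemma alt_sumD (V : nmodType) k (G G' : seq 'I_N -> V) :
  alt_sum k G + alt_sum k G' = alt_sum k (fun l => G l + G' l).
Proof.
elim: k G G' => [|k IH] G G' //=; rewrite IH.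
by apply: eq_alt_sum => l _ _; rewrite big_split.
Qed.

Lemma alt_sumZ (R : pzRingType) (V : lmodType R) (c : R) k (G : seq 'I_N -> V) :
  c *: alt_sum k G = alt_sum k (fun l => c *: G l).
Proof.
by rewrite (alt_sum_morph (phi := *:%R c)) ?scaler0// => x y; rewrite scalerDr.
Qed.

(** The number of particles which may own a letter placed in front of a given
    word: this is where N and N - 1 come from. *)
Lemma card_neq_head (R : pzRingType) (l : seq 'I_N) :
  #|[pred i | neq_head i l]|%:R = N%:R - (l != [::])%:R :> R.
Proof.
case: l => [|j l] /=; first by rewrite subr0 (eq_card (B := 'I_N))// card_ord.
have -> : #|[pred i | i != j]| = N.-1 by rewrite cardC1 card_ord.
by rewrite -[X in X%:R - _](prednK (leq_trans _ (ltn_ord j)))// -natr1 addrK.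
Qed.

Lemma alt_sum0 (V : nmodType) k : alt_sum k (fun _ : seq 'I_N => 0 : V) = 0.
Proof.
elim: k => //= k IH; rewrite -[RHS]IH.
by apply: eq_alt_sum => l _ _; rewrite big1.
Qed.

End AltSum.

(** * Freely independent particles on symmetrised tensors *)

Section Particles.
Context (R : realType) (X : ptopologicalType).
Context (P : probability (borelType X) R).
Local Notation T := (borelType X).
Implicit Types f g h : T -> R.

Lemma meanBZ f g c : bounded_mfun f -> bounded_mfun g ->
  mean P (fun x => f x - c * g x) = mean P f - c * mean P g.
Proof.
move=> bf bg; apply: RintegralBZ; exact: bounded_mfun_integrable.
Qed.

Lemma mean_cst c : mean P (fun=> c) = c.
Proof.
by rewrite /mean /Rintegral integral_cst//= probability_setT mule1.
Qed.

Lemma bounded_centering f : bounded_mfun f -> bounded_mfun (centering P f).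
Proof.
move=> Bf; have := bounded_mfunBZ (mean P f) Bf (bounded_mfun_cst _ 1).
by congr bounded_mfun; apply/funext => x; rewrite mulr1.
Qed.

Lemma centeringE f : centering P f = fun x => f x - mean P f * 1.
Proof. by apply/funext => x; rewrite mulr1. Qed.

Lemma centering_centered f : bounded_mfun f -> centering P f \in centered P.
Proof.
move=> Bf; have Bc := bounded_centering Bf.
rewrite inE; apply/andP; split.
  apply: integrable_sqr_Lfun2; first by case: Bc.
  exact/bounded_mfun_integrable/bounded_mfunM.
by rewrite centeringE meanBZ ?mean_cst ?mulr1 ?subrr//; exact: bounded_mfun_cst.
Qed.

Lemma mean_mul_centering f g : bounded_mfun f -> bounded_mfun g ->
  mean P (f \* centering P g) = mean P (f \* g) - mean P g * mean P f.
Proof.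
move=> Bf Bg; rewrite -meanBZ//; last exact: bounded_mfunM.
by congr mean; apply/funext => x /=; rewrite /centering; ring.
Qed.

Lemma centering_mul_centering f g : bounded_mfun f -> bounded_mfun g ->
  centering P (f \* centering P g) =
  fun x => centering P (f \* g) x - mean P g * centering P f x.
Proof.
move=> Bf Bg; apply/funext => x; rewrite /centering mean_mul_centering//=.
by rewrite /centering; ring.
Qed.

Section Space.
Context (N : nat) (K : particleSpace P N).

Lemma alternating_cons (l : 'I_N) g s : Defs.alternating P ((l, g) :: s) =
  [&& neq_head l (unzip1 s), g \in centered P & (Defs.alternating P s)].
Proof.
rewrite /Defs.alternating [unzip1 _]/= sorted_neq_head.
rewrite [unzip2 _]/= [all _ (_ :: _)]/=.
by rewrite andbACA -andbA; congr (_ && _); rewrite andbCA.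
Qed.

Lemma alternating_zip (l : seq 'I_N) (s : seq (T -> R)) : size l = size s ->
  sorted [rel i j : 'I_N | i != j] l ->
  all (fun g => `[< bounded_mfun g >]) s ->
  Defs.alternating P (zip l (map (centering P) s)).
Proof.
move=> ls sl bs; rewrite /Defs.alternating unzip1_zip ?size_map ?ls// sl/=.
rewrite unzip2_zip ?size_map ?ls// all_map.
by apply: sub_all bs => g /asboolP; exact: centering_centered.
Qed.

(** Elementary tensors are given only by their inner products; linearity in a
    letter follows since the difference of both sides is orthogonal to all
    elementary tensors, hence to itself. *)
Lemma ptensorBZ l g h c s :
  Defs.alternating P ((l, g) :: s) -> Defs.alternating P ((l, h) :: s) ->
  Defs.alternating P ((l, fun x => g x - c * h x) :: s) ->
  ptensor K ((l, fun x => g x - c * h x) :: s) =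
  ptensor K ((l, g) :: s) - c *: ptensor K ((l, h) :: s).
Proof.
move=> ag ah agh; apply/eqP; rewrite -subr_eq0; apply/eqP; apply: dotp_eq0.
set v := (X in dotp X X).
have v0 t : Defs.alternating P t -> dotp (ptensor K t) v = 0.
  move=> at_; rewrite dotpC /v -scaleN1r -(scaleN1r (c *: _)) !(dotpDl, dotpZl).
  rewrite !dotp_ptensor//=.
  case: eqP => [|_]; last by rewrite !(mulr0, addr0).
  case: t at_ => [|[i u] t] //= at_ _.
  rewrite !big_cons/=.
  have int f : Defs.alternating P ((l, f) :: s) ->
      P.-integrable setT (EFin \o (f \* u)).
    move: at_; rewrite !alternating_cons.
    move=> /and3P[_ /andP[u2 _] _] /and3P[_ /andP[f2 _] _].
    by apply/Lfun1_integrable; exact: Lfun2_mul_Lfun1.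
  have -> : dotL2 P (fun x => g x - c * h x) u = dotL2 P g u - c * dotL2 P h u.
    rewrite -RintegralBZ; [|exact: (int g)|exact: (int h)].
    by congr Rintegral; apply/funext => x /=; ring.
  ring.
rewrite {1}/v -scaleN1r -(scaleN1r (c *: _)) !(dotpDl, dotpZl).
by rewrite !v0//; ring.
Qed.

Context (M : particleOperators K).

Lemma particles_linear f : linear (particles M f).
Proof.
move=> c u v; rewrite /particles scaler_sumr -big_split/=.
by apply: eq_bigr => i _; rewrite linearP.
Qed.

Lemma particlesD f : {morph particles M f : u v / u + v}.
Proof. by move=> u v; rewrite -[u]scale1r particles_linear !scale1r. Qed.

(** The particle j which owns the first letter multiplies it by f; centring
    f * (g - <g>) gives the centred f * g minus <g> times the centred f. Each of
    the other N - 1 particles contributes <f> and its own copy of f in front. *)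
Lemma particles_word f g j w : B0fun f -> bounded_mfun g ->
  Defs.alternating P ((j, centering P g) :: w) ->
  let tens h := ptensor K ((j, centering P h) :: w) in
  particles M f (tens g) =
  ((N%:R - 1) * mean P f) *: tens g +
  (\sum_(i | i != j) ptensor K [:: (i, centering P f), (j, centering P g) & w] +
  ((mean P (f \* g) - mean P f * mean P g) *: ptensor K w +
  (tens (f \* g) - mean P g *: tens f))).
Proof.
move=> Bf bg ajw; set tens := fun _ => _.
have bf := B0fun_bounded_mfun Bf.
rewrite /particles (bigD1 j)//= pmul_eq//.
rewrite mean_mul_centering// centering_mul_centering//.
have alt h : bounded_mfun h -> Defs.alternating P ((j, centering P h) :: w).
  by move: ajw; rewrite !alternating_cons => /and3P[-> _ ->] /centering_centered ->.
rewrite ptensorBZ; [|exact/alt/bounded_mfunM|exact: alt|]; last first.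
  move: ajw; rewrite !alternating_cons => /and3P[-> _ ->]; rewrite andbT/=.
  rewrite -centering_mul_centering//; apply: centering_centered.
  exact/bounded_mfunM/bounded_centering.
rewrite (eq_bigr (fun i => mean P f *: tens g +
    ptensor K [:: (i, centering P f), (j, centering P g) & w])); last first.
  by move=> i ij; rewrite pmul_neq.
rewrite big_split/= sumr_const -scaler_nat scalerA.
rewrite (_ : #|_|%:R = N%:R - 1); last first.
  by have := card_neq_head R [:: j].
rewrite [mean P g * _]mulrC.
by rewrite [LHS]addrC -!addrA.
Qed.

(** The counterpart for N particles of the Fock tensor of the letters of s. *)
Definition sym_tensor (s : seq (T -> R)) : K :=
  alt_sum (size s) (fun l => ptensor K (zip l (map (centering P) s))).

Lemma particles_sym_tensor0 f : B0fun f ->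
  particles M f (sym_tensor [::]) =
  (N%:R * mean P f) *: sym_tensor [::] + sym_tensor [:: f].
Proof.
move=> Bf; rewrite /particles /sym_tensor/=.
rewrite (eq_bigr (fun i => mean P f *: pvacuum K +
    ptensor K [:: (i, centering P f)])); last by move=> i _; rewrite pmul_vacuum.
by rewrite big_split/= sumr_const card_ord -scaler_nat scalerA.
Qed.

Lemma particles_sym_tensor_cons f g s : B0fun f -> bounded_mfun g ->
  all (fun g => `[< bounded_mfun g >]) s ->
  particles M f (sym_tensor (g :: s)) =
  ((N%:R - 1) * mean P f) *: sym_tensor (g :: s) +
  (sym_tensor [:: f, g & s] +
  (((N%:R - (s != [::])%:R) * (mean P (f \* g) - mean P f * mean P g)) *:
     sym_tensor s +
  (sym_tensor (f \* g :: s) - mean P g *: sym_tensor (f :: s)))).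
Proof.
move=> Bf bg bs; rewrite /sym_tensor [size _]/=.
rewrite (alt_sum_morph (phi := particles M f)) ?particles0//;
  last exact: particlesD.
rewrite -[- (mean P g *: _)]scaleNr !alt_sumZ /= !alt_sumD.
apply: eq_alt_sum => l ls sl.
have alt_jl j : neq_head j l ->
    Defs.alternating P ((j, centering P g) :: zip l (map (centering P) s)).
  move=> jl; rewrite alternating_cons centering_centered// alternating_zip// andbT.
  by rewrite unzip1_zip ?size_map ?ls// jl.
rewrite (eq_bigr _ (fun j jl => particles_word Bf bg (alt_jl j jl)))/=.
rewrite !big_split/= -!scaler_sumr sumr_const -[ptensor K _ *+ _]scaler_nat scalerA.
rewrite (card_neq_head R l).
have -> : (l != [::]) = (s != [::]) by rewrite -!size_eq0 ls.
by rewrite sumrN -scaler_sumr scaleNr [_ * (N%:R - _)]mulrC.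
Qed.



End Space.
End Particles.

Lemma dotp_sym_tensor (R : realType) (X : ptopologicalType)
    (P : probability (borelType X) R) N (K : particleSpace P N) s :
  all (fun g => `[< bounded_mfun g >]) s ->
  dotp (sym_tensor K s) (pvacuum K) = (s == [::])%:R.
Proof.
case: s => [_|g s bs].
  by rewrite dotp_ptensor// big_nil.
rewrite (alt_sum_morph (phi := fun u => dotp u (pvacuum K))) ?dotp0l//;
  last first.
  by move=> u v; rewrite dotpDl.
rewrite -[RHS](alt_sum0 N R (size (g :: s))); apply: eq_alt_sum => l ls sl /=.
rewrite dotp_ptensor//; last exact: (@alternating_zip _ _ _ _ l (g :: s)).
by case: l ls {sl}.
Qed.

(** * Poisson averages *)

Definition poisson_weight (R : realType) (alpha : R) (N : nat) : R :=
  alpha ^+ N / N`!%:R * expR (- alpha).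

(** The averages of q n over a Poisson variable N of parameter alpha n tend to
    l, and so do its averages weighted by the falling factorials of N, each
    divided by the power of alpha n that gives it average 1. The weights are
    what makes the notion stable under the factor N / alpha n. The numbers
    e j n are the sums of the series: their existence is part of the notion, so
    that limits of series can be added and scaled. *)
Definition poisson_limit (R : realType) (alpha : nat -> R)
    (q : nat -> nat -> R) (l : R) :=
  exists e : nat -> nat -> R,
  (forall j n, series (fun N => ((N ^_ j)%:R / alpha n ^+ j * q n N) *
      poisson_weight (alpha n) N) @ \oo --> e j n) /\
  (forall j, e j @ \oo --> l).

Lemma cvg_ext (R : realType) (u v : nat -> R) (l : R) :
  u =1 v -> u @ \oo --> l -> v @ \oo --> l.
Proof. by move=> /funext ->. Qed.

Section PoissonLimit.
Context (R : realType) (alpha : nat -> R).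
Context (alpha_gt0 : forall n, 0 < alpha n).
Context (alpha_oo : (alpha n)^-1 @[n --> \oo] --> (0 : R)).

(** The falling factorial of order j cancels the first j factors of N!, so the
    series is that of the exponential with its index shifted by j. *)
Lemma series_factorial_moment (c : R) j : 0 < c ->
  series (fun N => ((N ^_ j)%:R / c ^+ j * 1) * poisson_weight c N)
    @ \oo --> (1 : R).
Proof.
move=> c0.
have E : series (exp_coeff c) n * expR (- c) @[n --> \oo] --> (1 : R).
  rewrite -[1](expRxMexpNx_1 c); apply: cvgMl.
  exact: is_cvg_series_exp_coeff.
rewrite -(cvg_shiftn j) /=.
apply: cvg_trans E; apply: near_eq_cvg; near=> n.
rewrite /series/= /exp_coeff/= addnC.
rewrite [RHS](big_cat_nat (n:=j)) ?leq_addr//=.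
rewrite [X in _ = X + _]big_nat [X in _ = X + _]big1 ?add0r; last first.
  by move=> i /andP[_ ij]; rewrite ffact_small// mul0r mulr1 mul0r.
have -> (g : nat -> R) : \sum_(j <= i < j + n) g i = \sum_(0 <= i < n) g (i + j)%N.
  by rewrite -{1}(add0n j) big_addn addKn.
rewrite mulr_suml.
apply: eq_bigr => i _.
rewrite /poisson_weight mulr1 mulrA; congr (_ * _).
have /(congr1 (fun k => k%:R : R)) := ffact_fact (leq_addl i j).
rewrite addnK natrM => <-.
rewrite exprD; field.
by rewrite !pnatr_eq0 -!lt0n fact_gt0 ffact_gt0 leq_addl expf_neq0 ?gt_eqF.
Unshelve. all: by end_near. Qed.

Lemma poisson_limitE q l : poisson_limit alpha q l ->
  limn (series (fun N => q n N * poisson_weight (alpha n) N))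
    @[n --> \oo] --> l.
Proof.
move=> [e [eE /(_ 0)]]; apply: cvg_ext => n.
apply/esym/cvg_lim => //; have := eE 0 n.
under [X in series X]eq_fun do rewrite ffactn0 expr0 divr1 mul1r.
exact.
Qed.

Lemma poisson_limit_cst1 : poisson_limit alpha (fun _ _ => 1) 1.
Proof.
exists (fun _ _ => 1); split => [j n|j]; last exact: cvg_cst.
exact: series_factorial_moment.
Qed.

Lemma poisson_limit0 : poisson_limit alpha (fun _ _ => 0) 0.
Proof.
exists (fun _ _ => 0); split => [j n|j]; last exact: cvg_cst.
rewrite (_ : series _ = cst 0); first exact: cvg_cst.
by apply/funext => n'; rewrite /series/= big1// => i _; rewrite mulr0 mul0r.
Qed.

Lemma poisson_limitD q1 q2 l1 l2 :
  poisson_limit alpha q1 l1 -> poisson_limit alpha q2 l2 ->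
  poisson_limit alpha (fun n N => q1 n N + q2 n N) (l1 + l2).
Proof.
move=> [e1 [e1E e1l]] [e2 [e2E e2l]].
exists (fun j n => e1 j n + e2 j n); split => [j n|j]; last exact: cvgD.
apply: cvg_ext (cvgD (e1E j n) (e2E j n)) => m.
rewrite -[LHS]/(series _ m + series _ m) -big_split/=.
by apply: eq_bigr => N _ /=; ring.
Qed.

Lemma poisson_limitZ (c : nat -> R) (cl : R) q l :
  c @ \oo --> cl -> poisson_limit alpha q l ->
  poisson_limit alpha (fun n N => c n * q n N) (cl * l).
Proof.
move=> ccl [e [eE el]].
exists (fun j n => c n * e j n); split => [j n|j]; last exact: cvgM.
apply: cvg_ext (cvgMr (a := c n) (eE j n)) => m.
rewrite /series/= mulr_sumr; apply: eq_bigr => N _; ring.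
Qed.

(** Writing N = (N - j) + j turns N times the falling factorial of order j into
    the one of order j + 1 plus j times itself; the second part is divided by
    alpha n and disappears. *)
Lemma poisson_limitX q l : poisson_limit alpha q l ->
  poisson_limit alpha (fun n N => N%:R / alpha n * q n N) l.
Proof.
move=> [e [eE el]].
exists (fun j n => e j.+1 n + j%:R / alpha n * e j n); split => [j n|j].
- apply: cvg_ext (cvgD (eE j.+1 n) (cvgMr (a := j%:R / alpha n) (eE j n))) => m.
  rewrite -[LHS]/(series _ m + _ * series _ m) mulr_sumr -big_split/=.
  apply: eq_bigr => N _.
  have -> : N%:R = (N%:R - j%:R) + j%:R :> R by rewrite subrK.
  have -> : (N ^_ j.+1)%:R = (N ^_ j)%:R * (N%:R - j%:R) :> R.
    rewrite ffactnSr natrM; have [jN|Nj] := leqP j N; first by rewrite natrB.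
    by rewrite ffact_small// !mul0r.
  rewrite exprS; field.
  by rewrite expf_neq0 ?gt_eqF.
rewrite -[l]addr0 -[X in _ --> _ + X](mul0r l); apply: cvgD; first exact: el.
apply: cvgM; last exact: el.
by rewrite -(mulr0 j%:R); apply: cvgMr.
Qed.

Lemma poisson_limit_ext q q' l l' :
  (forall n N, q n N = q' n N) -> l = l' ->
  poisson_limit alpha q l -> poisson_limit alpha q' l'.
Proof.
by move=> qq' ->; congr (poisson_limit alpha _ _); apply/funext => n; apply/funext.
Qed.

Lemma poisson_limit_affine (c d : nat -> R) (cl : R) q l :
  c @ \oo --> cl -> d @ \oo --> (0 : R) -> poisson_limit alpha q l ->
  poisson_limit alpha (fun n N => (N%:R / alpha n * c n + d n) * q n N) (cl * l).
Proof.
move=> ccl d0 ql.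
have := poisson_limitD (poisson_limitZ ccl (poisson_limitX ql))
  (poisson_limitZ d0 ql).
by apply: poisson_limit_ext => [n N|]; ring.
Qed.

End PoissonLimit.

(** * Means over the exhausting sets *)

Section Normalized.
Context (R : realType) (X : ptopologicalType).
Context (sigma : {measure set (borelType X) -> \bar R}).
Context (sigma_radon : radon sigma).
Local Notation T := (borelType X).

(** The normalised restriction gives no mass to the complement of L, and on
    subsets of L it is sigma scaled by the inverse of sigma L. *)
Lemma mean_normalized_restr (L : set T) (mL : measurable L) f :
  (0 < sigma L)%E -> (sigma L < +oo)%E -> B0fun f ->
  mean (normalized_restr sigma mL) f =
  (fine (sigma L))^-1 * \int[sigma]_(x in L) f x.
Proof.
move=> L0 Loo Bf; rewrite /mean /Rintegral.
set P := normalized_restr sigma mL.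
have PE U : P U = (sigma (U `&` L) * (fine (sigma L))^-1%:E)%E.
  (* The definitions are unfolded by hand to give all occurrences of the total
     mass the same form. *)
  rewrite -[LHS]/((if (sigma (setT `&` L) == 0) || (sigma (setT `&` L) == +oo)
    then fun U => \d_(point : T) U
    else fun U => sigma (U `&` L) * (fine (sigma (setT `&` L)))^-1%:E) U)%E.
  by rewrite setTI gt_eqF//= lt_eqF.
have k0 : 0 <= (fine (sigma L))^-1 by rewrite invr_ge0 fine_ge0.
have intf : sigma.-integrable L (EFin \o f).
  exact: integrableS (B0fun_integrable sigma_radon Bf).
rewrite [X in fine X = _](negligible_integral (N := ~` L))//; last 3 first.
- exact: measurableC.
- by apply/bounded_mfun_integrable; exact: B0fun_bounded_mfun.
- by apply: etrans (PE _) _; rewrite setICl measure0 mul0e.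
rewrite setTD setCK.
rewrite (@eq_measure_integral _ _ _ _ (mscale (NngNum k0) sigma)); last first.
  by move=> A mA AL; apply: etrans (PE _) _; rewrite /mscale/= setIidl// muleC.
rewrite integral_mscale// fineM//.
by have := integrable_fin_num mL intf.
Qed.

Context (L : nat -> set T) (L_B0 : forall n, B0set (L n)).
Context (L_incr : forall n, L n `<=` L n.+1).
Context (L_cover : \bigcup_n L n = setT).

Let L_le n m : (n <= m)%N -> L n `<=` L m.
Proof.
move=> /subnKC <-; elim: (m - n)%N => [|k IH]; first by rewrite addn0.
by rewrite addnS => x /IH; exact: L_incr.
Qed.

(** The sets L n need not eventually contain the support of f, which is why
    dominated convergence is called for. *)
Lemma cvg_Rintegral_exhaustion f : B0fun f ->
  (\int[sigma]_(x in L n) f x) @[n --> \oo] --> \int[sigma]_x f x.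
Proof.
move=> Bf; have intf := B0fun_integrable sigma_radon Bf.
rewrite /Rintegral; apply: fine_cvg; rewrite fineK; last first.
  by have := integrable_fin_num measurableT intf.
under eq_cvg do rewrite integral_mkcond.
apply: (@dominated_cvg _ _ _ sigma setT measurableT _ _ (fun x => `|f x|%:E)) => //.
- move=> n; apply/(measurable_restrictT _ (L_B0 n).1).
  exact: measurable_funTS (measurable_int _ intf).
- move=> x _; apply: cvg_near_cst.
  have [m _ Lmx] : (\bigcup_n L n) x by rewrite L_cover.
  near=> n; rewrite patchE ifT// inE; apply: L_le Lmx.
  by near: n; exact: nbhs_infty_ge.
- by have := integrable_abse intf.
- move=> n x _; rewrite patchE; case: ifPn => _ //.
  by rewrite abse0 lee_fin.
Unshelve. all: by end_near. Qed.

Lemma cvg_inv_measure : sigma setT = +oo%E ->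
  (forall n, (0 < sigma (L n))%E) ->
  (fine (sigma (L n)))^-1 @[n --> \oo] --> (0 : R).
Proof.
move=> sT L0.
have cvgL : sigma (L n) @[n --> \oo] --> +oo%E.
  rewrite -sT -L_cover; apply: nondecreasing_cvg_mu.
  - by move=> n; exact: (L_B0 n).1.
  - by rewrite L_cover.
  - by apply/nondecreasing_seqP => n; apply/subsetPset.
have fin n : sigma (L n) \is a fin_num.
  by rewrite ge0_fin_numE//; exact: sigma_radon.
apply/gtr0_cvgV0.
  by apply: nearW => n; rewrite fine_gt0// L0/= -ge0_fin_numE.
apply/cvgryPgt => A.
have /cvgeyPgt/(_ A) := cvgL.
by apply: filterS => n; rewrite -[X in (_ < X)%E -> _](fineK (fin n)) lte_fin.
Qed.

End Normalized.

(** * Words of operators and the limit *)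

Lemma big_comp_foldr (A B I : Type) (G : B -> A -> A) (f : I -> B) (r : seq I) u :
  (\big[comp/id]_(i <- r) G (f i)) u = foldr G u (map f r).
Proof. by elim: r => [|i r IH]; rewrite ?big_nil// big_cons/= IH. Qed.

Lemma dotp_foldr (R : realType) (V : hilbertType R) (B : Type) (G : B -> V -> V)
    (fs : seq B) (w : V) (c : R) u v : (forall f, linear (G f)) ->
  dotp (foldr G (c *: u + v) fs) w =
  c * dotp (foldr G u fs) w + dotp (foldr G v fs) w.
Proof.
move=> linG; suff -> : foldr G (c *: u + v) fs = c *: foldr G u fs + foldr G v fs.
  exact: dotpPl.
by elim: fs => //= f fs ->; exact: linG.
Qed.

Lemma poisson_particles_foldr (R : realType) (X : ptopologicalType)
    (P : probability (borelType X) R) (K : forall N, particleSpace P N)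
    (M : forall N, particleOperators (K N)) fs (u : finSeq K) N :
  foldr (poisson_particles M) u fs N = foldr (particles (M N)) (u N) fs.
Proof. by elim: fs => //= f fs ->. Qed.

Section Limit.
Context (R : realType) (X : ptopologicalType).
Context (sigma : {measure set (borelType X) -> \bar R}).
Context (sigma_radon : radon sigma).
Context (sigma_infty : sigma [set: borelType X] = +oo%E).
Context (L : nat -> set (borelType X)) (L_B0 : forall n, B0set (L n)).
Context (L_incr : forall n, L n `<=` L n.+1).
Context (L_cover : \bigcup_n L n = [set: borelType X]).
Context (L_gt0 : forall n, (0 < sigma (L n))%E).
Context (K : forall n N, particleSpace (normalized_restr sigma (L_B0 n).1) N).
Context (M : forall n N, particleOperators (K n N)).
Context (F : fullFock sigma) (a : fockOperators F).
Local Notation T := (borelType X).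
Local Notation alpha := (fun n => fine (sigma (L n))).
Local Notation allB0 := (all (fun g : T -> R => `[< B0fun g >])).
Implicit Types (f g : T -> R) (s fs : seq (T -> R)).

Lemma allB0_bounded s : allB0 s -> all (fun g => `[< bounded_mfun g >]) s.
Proof. by apply: sub_all => g /asboolP Bg; apply/asboolP; case: Bg. Qed.

Lemma allB0_Lfun2 s : allB0 s -> all [in Lfun sigma 2%:E] s.
Proof. by apply: sub_all => g /asboolP /(B0fun_Lfun2 sigma_radon). Qed.

Lemma alpha_gt0 n : 0 < fine (sigma (L n)).
Proof. by rewrite fine_gt0// L_gt0/=; exact: sigma_radon. Qed.

Lemma meanE n f : B0fun f ->
  mean (normalized_restr sigma (L_B0 n).1) f =
  (fine (sigma (L n)))^-1 * \int[sigma]_(x in L n) f x.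
Proof. by move=> Bf; rewrite mean_normalized_restr//; exact: sigma_radon. Qed.

(** Induction on the number of operators, the last of which is the first to act
    on the word s; s is arbitrary because this action changes it. *)
Lemma poisson_limit_words fs s : allB0 fs -> allB0 s ->
  poisson_limit alpha
    (fun n N => dotp (foldr (particles (M n N)) (sym_tensor (K n N) s) fs)
                     (pvacuum (K n N)))
    (dotp (foldr (free_poisson a) (tensor F s) fs) (vacuum F)).
Proof.
have inv0 : (fine (sigma (L n)))^-1 @[n --> \oo] --> (0 : R).
  exact: cvg_inv_measure.
have intL f : B0fun f ->
    (\int[sigma]_(x in L n) f x) @[n --> \oo] --> \int[sigma]_x f x.
  exact: cvg_Rintegral_exhaustion.
have mean0 f : B0fun f ->
    ((fine (sigma (L n)))^-1 * \int[sigma]_(x in L n) f x) @[n --> \oo] --> (0 : R).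
  by move=> Bf; rewrite -(mul0r (\int[sigma]_x f x)); apply: cvgM => //; exact: intL.
elim/last_ind: fs s => [|fs f IH] s Bfs Bs.
  have -> : dotp (foldr (free_poisson a) (tensor F s) [::]) (vacuum F) =
      (s == [::])%:R.
    rewrite dotp_tensor//; last exact: allB0_Lfun2.
    by case: s {Bs} => [|g s]//=; rewrite big_nil.
  case: s Bs => [|g s] Bs.
    apply: (poisson_limit_ext _ _ (poisson_limit_cst1 alpha_gt0)) => // n N.
    by rewrite dotp_sym_tensor.
  apply: (poisson_limit_ext _ _ (poisson_limit0 alpha)) => // n N.
  by rewrite dotp_sym_tensor//; exact: allB0_bounded.
move: Bfs; rewrite all_rcons => /andP[/asboolP Bf Bfs].
have affine := poisson_limit_affine alpha_gt0 inv0.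
case: s Bs => [_|g s /= /andP[/asboolP Bg Bs]].
  have Bf1 : allB0 [:: f] by rewrite /= andbT; apply/asboolP.
  apply: (poisson_limit_ext _ _ (poisson_limitD
    (affine _ _ _ _ _ (intL f Bf) (cvg_cst 0) (IH [::] Bfs isT))
    (IH [:: f] Bfs Bf1))) => [n N|].
    rewrite foldr_rcons particles_sym_tensor0// dotp_foldr; last first.
      by move=> h; exact: particles_linear.
    by rewrite meanE//; ring.
  rewrite foldr_rcons free_poisson_vacuum// dotp_foldr//.
  by move=> h; exact: free_poisson_linear.
have Bfg : B0fun (f \* g) by exact: B0funM.
have [Bf' Bg' Bfg'] : [/\ `[< B0fun f >], `[< B0fun g >] & `[< B0fun (f \* g) >]].
  by split; apply/asboolP.
have IHg := IH (g :: s) Bfs; rewrite /= Bg' in IHg.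
have IHfg := IH [:: f, g & s] Bfs; rewrite /= Bf' Bg' in IHfg.
have IHm := IH (f \* g :: s) Bfs; rewrite /= Bfg' in IHm.
have IHf := IH (f :: s) Bfs; rewrite /= Bf' in IHf.
(* c1, c2, c3, c4 are the coefficients of the particle side: c2 multiplies
   N / alpha in the contraction, c1 and c3 are the corrections due to N - 1
   instead of N, and c4 comes from centring the product. *)
pose c1 n : R := - ((fine (sigma (L n)))^-1 * \int[sigma]_(x in L n) f x).
have c1_0 : c1 @ \oo --> (0 : R).
  by rewrite -oppr0; apply: cvgN; exact: mean0.
pose c2 n : R := \int[sigma]_(x in L n) (f \* g) x -
  (fine (sigma (L n)))^-1 * \int[sigma]_(x in L n) f x *
  \int[sigma]_(x in L n) g x.
have c2_l : c2 @ \oo --> \int[sigma]_x (f \* g) x.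
  rewrite -[X in _ --> X]subr0 -(mul0r (\int[sigma]_x g x)).
  by apply: cvgB; [exact: intL|apply: cvgM; [exact: mean0|exact: intL]].
pose c3 n : R := - (s != [::])%:R * ((fine (sigma (L n)))^-1 * c2 n).
have c3_0 : c3 @ \oo --> (0 : R).
  rewrite -(mulr0 (- (s != [::])%:R)); apply: cvgMr.
  by rewrite -(mul0r (\int[sigma]_x (f \* g) x)); apply: cvgM.
pose c4 n : R := - ((fine (sigma (L n)))^-1 * \int[sigma]_(x in L n) g x).
have c4_0 : c4 @ \oo --> (0 : R).
  by rewrite -oppr0; apply: cvgN; exact: mean0.
apply: (poisson_limit_ext _ _
  (poisson_limitD (affine _ _ _ _ _ (intL f Bf) c1_0 (IHg Bs))
  (poisson_limitD (IHfg Bs)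
  (poisson_limitD (affine _ _ _ _ _ c2_l c3_0 (IH s Bfs Bs))
  (poisson_limitD (poisson_limitZ c4_0 (IHf Bs)) (IHm Bs)))))) => [n N|].
  have linM h : linear (particles (M n N) h) by exact: particles_linear.
  rewrite foldr_rcons particles_sym_tensor_cons//; last 2 first.
  - exact: B0fun_bounded_mfun.
  - exact: allB0_bounded.
  rewrite [sym_tensor _ (f \* g :: s) - _]addrC -[- (_ *: sym_tensor _ _)]scaleNr.
  rewrite dotp_foldr// -[in RHS](scale1r (sym_tensor _ [:: f, g & s])).
  rewrite !dotp_foldr// !meanE// /c1 /c3 /c2 /c4; ring.
rewrite foldr_rcons free_poisson_cons//; last exact: allB0_Lfun2.
have linF h : linear (free_poisson a h) by exact: free_poisson_linear.
rewrite dotp_foldr// -[in RHS](scale1r (tensor F [:: f, g & s])) !dotp_foldr//; ring.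
Qed.


End Limit.

Theorem theorem16 (R : realType) (X : ptopologicalType)
  (X_polish : polish_space R X) (X_lc : locally_compact [set: X])
  (sigma : {measure set (borelType X) -> \bar R})
  (sigma_radon : radon sigma) (sigma_nonatomic : nonatomic sigma)
  (sigma_infty : sigma [set: borelType X] = +oo%E)
  (Lambda : nat -> set (borelType X))
  (Lambda_B0 : forall n, B0set (Lambda n))
  (Lambda_incr : forall n, Lambda n `<=` Lambda n.+1)
  (Lambda_cover : \bigcup_n Lambda n = [set: borelType X])
  (Lambda_gt0 : forall n, (0 < sigma (Lambda n))%E)
  (K : forall n N, particleSpace (normalized_restr sigma (Lambda_B0 n).1) N)
  (M : forall n N, particleOperators (K n N))
  (F : fullFock sigma) (a : fockOperators F)
  (k : nat) (k_gt0 : (0 < k)%N)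
  (f : 'I_k -> borelType X -> R) (f_B0 : forall i, B0fun (f i)) :
  poisson_trace (fine (sigma (Lambda n)))
    (\big[comp/id]_(i < k) poisson_particles (M n) (f i))
    @[n --> \oo]
  --> vacuum_trace (\big[comp/id]_(i < k) free_poisson a (f i)).
Proof.
rewrite /vacuum_trace big_comp_foldr; set fs := map f _.
have Bfs : all (fun g => `[< B0fun g >]) fs.
  by rewrite all_map; apply/allP => i _ /=; apply/asboolP.
have := poisson_limitE (poisson_limit_words sigma_radon sigma_infty
  Lambda_incr Lambda_cover Lambda_gt0 M a Bfs (s := [::]) isT).
apply: cvg_ext => n; rewrite /poisson_trace; congr (limn (series _)).
apply/funext => N; rewrite big_comp_foldr poisson_particles_foldr/= dfwithin.
by [].
Qed.
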